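(* Let $n\ge1$ and let $\pi,\sigma\in\mathfrak{B}_n$ have respective length vectors $(\ell_1,\ell_2,\ell_3,\ell_4)$ and $(m_1,m_2,m_3,m_4)$, with $\pi\le\sigma$. Let $d_i=|\ell_i-m_i|+1$ for $i\in\{1,2,3,4\}$, and let $\mu$ be the M\''obius function of $(\mathfrak{B}_n,\le)$. Then: (1) if $d_1=d_2=d_3=d_4=1$, then $\mu(\pi,\sigma)=1$; (2) if $d_1+d_4=d_2+d_3=3$, then $\mu(\pi,\sigma)=-1$; (3) if $d_1=d_2=d_3=d_4=2$, then $\mu(\pi,\sigma)=3$; (4) if $d_1=d_2=d_3=d_4=a\ge 3$, then $\mu(\pi,\sigma)=4$; (5) if for some $a\ge2$ we have $d_1=d_4=a$ and $d_2=a\pm1$, $d_3=a\mp1$, or if for some $a\ge 2$ we have $d_2=d_3=a$ and $d_1=a\pm1$, $d_4=a\mp1$, then $\mu(\pi,\sigma)=1$; (6) if for some $a\ge2$ exactly one of $d_1,d_4$ equals $a$, exactly one of $d_2,d_3$ equals $a$, and the other two values equal $a+1$, then $\mu(\pi,\sigma)=-2$; (7) if $(d_1,d_2,d_3,d_4)$ satisfies none of the six hypotheses in items (1)-(6) of this list, then $\mu(\pi,\sigma)=0$.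
   Context: $\mathfrak{S}_n$ is the set of permutations of $[n]=\{1,\dots,n\}$, in one-line notation. A reduction of $\omega\in\mathfrak{S}_n$ interchanges $\omega(i)$ and $\omega(j)$ for some $i<j$ with $\omega(i)>\omega(j)$. Bruhat order: $\pi\le\sigma$ if $\pi$ is obtained from $\sigma$ by a (possibly empty) sequence of reductions. $\mathfrak{B}_n\subseteq\mathfrak{S}_n$ is the set of bigrassmannian permutations (both $\omega$ and $\omega^{-1}$ have exactly one descent), with the order inherited from Bruhat order; equivalently $\omega=1\cdots a\,(b+1)\cdots c\,(a+1)\cdots b\,(c+1)\cdots n$ for a unique triple $0\le a<b<c\le n$. The length vector of such an element is $(\ell_1,\ell_2,\ell_3,\ell_4)=(a+1,b-a,c-b,n+1-c)$. The M\''obius function is defined recursively by $\mu(\pi,\pi)=1$ and $\mu(\pi,\sigma)=-\sum_{\tau\in\mathfrak{B}_n:\ \pi\le\tau<\sigma}\mu(\pi,\tau)$ for $\pi<\sigma$. *)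

(* Defs.v *)
From HB Require Import structures.
From mathcomp Require Import all_boot all_order all_fingroup all_algebra.
From mathcomp Require Import zify.

Set Implicit Arguments.
Unset Strict Implicit.
Unset Printing Implicit Defensive.

Import Order.TTheory GRing.Theory.

(* The permutations of {1, ..., n} are modelled by 'S_n, the permutations of
   'I_n = {0, ..., n-1}: positions and values are both shifted by one. *)

Section Bruhat.
Variable n : nat.
Implicit Types w s t p : 'S_n.

(* In MathComp (x * y)%g i = y (x i), so (tperm i j * s)%g is s with its values
   at the positions i and j interchanged. *)
Definition reduction s t : bool :=
  [exists i : 'I_n, exists j : 'I_n,
    [&& i < j, s j < s i & t == (tperm i j * s)%g]].

Definition bruhat_le p s : bool := connect reduction s p.

Definition descents w : {set 'I_n} :=
  [set i : 'I_n | [exists j : 'I_n, (j == i.+1 :> nat) && (w j < w i)]].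

Definition bigrassmannian w : bool :=
  (#|descents w| == 1) && (#|descents w^-1%g| == 1).

(* A strictly increasing statistic along reductions, used for antisymmetry. *)
Let stat w := \sum_(i < n) i * w i.

Lemma reduction_stat s t : reduction s t -> stat s < stat t.
Proof.
case/existsP=> i /existsP[j /and3P[lt_ij lt_sji /eqP->]].
have neq_ji : j != i by rewrite -val_eqE /= gtn_eqF.
rewrite /stat (bigD1 i) //= (bigD1 j) //=.
rewrite [X in _ < X](bigD1 i) //= [X in _ < _ + X](bigD1 j) //=.
rewrite !permM tpermL tpermR !addnA.
rewrite [X in _ < _ + X](eq_bigr (fun k : 'I_n => k * s k)); last first.
  by move=> k /andP[neq_ki neq_kj]; rewrite permM tpermD // eq_sym.
rewrite ltn_add2r.
move: (nat_of_ord i) (nat_of_ord j) (nat_of_ord (s i)) (nat_of_ord (s j)) lt_ij lt_sji.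
move=> a b c d lt_ab lt_dc.
nia.
Qed.

Lemma bruhat_le_refl : reflexive bruhat_le.
Proof. by move=> s; apply: connect0. Qed.

Lemma bruhat_le_trans : transitive bruhat_le.
Proof. by move=> t s p le_st le_tp; apply: connect_trans le_tp le_st. Qed.

Lemma bruhat_le_stat p s : bruhat_le p s -> p != s -> stat s < stat p.
Proof.
case/connectP=> q; elim: q s => [|t q IHq] s /=.
  by move=> _ ->; rewrite eqxx.
case/andP=> /reduction_stat lt_st tq def_p _.
have [-> // | neq_pt] := eqVneq p t.
exact: ltn_trans lt_st (IHq t tq def_p neq_pt).
Qed.

Lemma bruhat_le_anti : antisymmetric bruhat_le.
Proof.
move=> p s /andP[le_ps le_sp]; apply/eqP; apply: contraT => neq_ps.
have lt_sp := bruhat_le_stat le_ps neq_ps.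
rewrite eq_sym in neq_ps.
by have := ltn_trans lt_sp (bruhat_le_stat le_sp neq_ps); rewrite ltnn.
Qed.

End Bruhat.

Record bigrass (n : nat) : predArgType :=
  Bigrass { bigrass_perm :> 'S_n; _ : bigrassmannian bigrass_perm }.

HB.instance Definition _ n := [isSub for @bigrass_perm n].
HB.instance Definition _ n := [Finite of bigrass n by <:].

Section BigrassOrder.
Variable n : nat.
Implicit Types x y z : bigrass n.

Definition bigrass_le x y : bool := bruhat_le x y.

Lemma bigrass_le_refl : reflexive bigrass_le.
Proof. by move=> x; apply: bruhat_le_refl. Qed.

Lemma bigrass_le_anti : antisymmetric bigrass_le.
Proof. by move=> x y /bruhat_le_anti/val_inj. Qed.

Lemma bigrass_le_trans : transitive bigrass_le.
Proof. by move=> y x z; apply: bruhat_le_trans. Qed.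

End BigrassOrder.

Fact bigrass_display : Order.disp_t. Proof. exact: Order.Disp tt tt. Qed.

HB.instance Definition _ n :=
  Order.Le_isPOrder.Build bigrass_display (bigrass n)
    (@bigrass_le_refl n) (@bigrass_le_anti n) (@bigrass_le_trans n).

(* 1-based one-line notation. *)
Definition one_line n (w : 'S_n) : seq nat := [seq (w i).+1 | i <- enum 'I_n].

(* iota m k is the list m, m + 1, ..., m + k - 1, so the right-hand side of the
   first equation is the word 1...a (b+1)...c (a+1)...b (c+1)...n. *)
Definition is_length_vector n (w : 'S_n) (l1 l2 l3 l4 : nat) : Prop :=
  exists a b c : nat,
    [/\ a < b, b < c & c <= n] /\
    one_line w =
      iota 1 a ++ iota b.+1 (c - b) ++ iota a.+1 (b - a) ++ iota c.+1 (n - c) /\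
    [/\ l1 = a.+1, l2 = b - a, l3 = c - b & l4 = n.+1 - c].

Section Mobius.
Variables (d : Order.disp_t) (T : finPOrderType d).
Implicit Types x y z : T.
Local Open Scope ring_scope.

Fixpoint mobius_rec (k : nat) x y : int :=
  if x == y then 1
  else if k is k'.+1 then
    if (x < y)%O then - \sum_(z : T | (x <= z < y)%O) mobius_rec k' x z else 0
  else 0.

(* The depth #|T| of the recursion suffices: see mobius_lt. *)
Definition mobius x y : int := mobius_rec #|T| x y.

Lemma mobius_rec_stable k y x :
  (#|[pred z : T | (z < y)%O]| <= k)%N ->
  mobius_rec k x y = mobius_rec k.+1 x y.
Proof.
elim: k y => [|k IHk] y.
  rewrite leqn0 => /eqP/card0_eq y_min /=; case: eqVneq => // _.
  by have := y_min x; rewrite !inE => ->.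
move=> le_yk; rewrite [RHS]/= [LHS]/=; case: eqVneq => // _; case: ifP => // _.
congr (- _); apply: eq_bigr => z /andP[_ lt_zy]; apply: IHk.
rewrite -ltnS; apply: leq_trans le_yk; apply: proper_card; apply/properP.
split; first by apply/subsetP=> t; rewrite !inE => /lt_trans->.
by exists z; rewrite !inE ?ltxx.
Qed.

Lemma mobius_refl x : mobius x x = 1.
Proof. by rewrite /mobius; case: #|T| => [|k] /=; rewrite eqxx. Qed.

Lemma mobius_lt x y :
  (x < y)%O -> mobius x y = - \sum_(z : T | (x <= z < y)%O) mobius x z.
Proof.
move=> lt_xy; rewrite {1}/mobius mobius_rec_stable ?max_card //=.
by rewrite lt_eqF // lt_xy.
Qed.

End Mobius.

(* Here d_i stands for |l_i - m_i| + 1. *)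
Section Cases.
Variables d1 d2 d3 d4 : nat.

Definition case1 : Prop := [/\ d1 = 1, d2 = 1, d3 = 1 & d4 = 1].

Definition case2 : Prop := d1 + d4 = 3 /\ d2 + d3 = 3.

Definition case3 : Prop := [/\ d1 = 2, d2 = 2, d3 = 2 & d4 = 2].

Definition case4 : Prop :=
  exists2 a, 3 <= a & [/\ d1 = a, d2 = a, d3 = a & d4 = a].

Definition one_up_one_down (a x y : nat) : Prop :=
  (x = a + 1 /\ y = a - 1) \/ (x = a - 1 /\ y = a + 1).

Definition case5 : Prop :=
  (exists2 a, 2 <= a & [/\ d1 = a, d4 = a & one_up_one_down a d2 d3]) \/
  (exists2 a, 2 <= a & [/\ d2 = a, d3 = a & one_up_one_down a d1 d4]).

Definition one_same_one_up (a x y : nat) : Prop :=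
  (x = a /\ y = a + 1) \/ (x = a + 1 /\ y = a).

Definition case6 : Prop :=
  exists2 a, 2 <= a & one_same_one_up a d1 d4 /\ one_same_one_up a d2 d3.

End Cases.

(* Main.v *)
Require Import Defs.
From HB Require Import structures.
From mathcomp Require Import all_boot all_order all_fingroup all_algebra.
From mathcomp Require Import zify ring.

Set Implicit Arguments.
Unset Strict Implicit.
Unset Printing Implicit Defensive.

Import Order.TTheory GRing.Theory.

(* In terms of length vectors, pi <= sigma iff l1 >= m1, l2 <= m2, l3 <= m3 and
   l4 >= m4.  Since the lengths add up to n + 2, the interval [pi, sigma] is the
   set of lattice points 0 <= x <= e with x1 + x4 = x2 + x3, where e = d - 1.
   These points form the monoid generated by p = (1,1,0,0), q = (1,0,1,0),
   r = (0,1,0,1) and s = (0,0,1,1) subject to p + s = q + r, ordered by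
   divisibility, so its zeta function has the generating series
   (1 - T) / ((1-p)(1-q)(1-r)(1-s)) with T = p + s = (1,1,1,1).  Hence the Moebius
   function has the series (1-p)(1-q)(1-r)(1-s) / (1 - T), whose coefficients are
   1, 3, 4, 4, ... at 0, T, 2T, ..., -1, -2, -2, ... at g + kT for each generator
   g, and 1 at u + kT for u one of p + q, p + r, q + s, r + s. *)

(** * Bigrassmannian permutations as block exchanges *)

Ltac solve_ifs := repeat (case: ifP => ?); lia.

Definition block_swap (a b c i : nat) : nat :=
  if i < a then i else if i < a + (c - b) then i - a + b
  else if i < c then i - (c - b) else i.

Lemma block_swapK a b c i : a < b -> b < c ->
  block_swap a (a + (c - b)) c (block_swap a b c i) = i.
Proof.
by move=> ab bc; rewrite {2}/block_swap; repeat (case: ifP => ?);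
  rewrite /block_swap; solve_ifs.
Qed.

Lemma ltn_block_swap n a b c i : b < c -> c <= n -> i < n -> block_swap a b c i < n.
Proof. rewrite /block_swap; solve_ifs. Qed.

Definition block_form n (w : 'S_n) a b c : Prop :=
  [/\ a < b, b < c, c <= n & forall i : 'I_n, w i = block_swap a b c i :> nat].

Lemma block_form_inj n (w w' : 'S_n) a b c :
  block_form w a b c -> block_form w' a b c -> w = w'.
Proof.
by move=> [_ _ _ ww] [_ _ _ ww']; apply/permP=> i; apply/val_inj; rewrite /= ww ww'.
Qed.

Lemma block_formV n (w : 'S_n) a b c :
  block_form w a b c -> block_form w^-1 a (a + (c - b)) c.
Proof.
move=> [ab bc cn ww]; split; [lia | lia | lia | move=> i].
by rewrite -{2}[i](permKV w) ww block_swapK.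
Qed.

Lemma block_form_descents n (w : 'S_n) a b c :
  block_form w a b c -> #|descents w| == 1.
Proof.
move=> [ab bc cn ww]; have pn : (a + (c - b)).-1 < n by lia.
apply/cards1P; exists (Ordinal pn); apply/setP=> i; rewrite !inE -val_eqE /=.
apply/existsP/eqP => [[j /andP[/eqP ji]]|ip].
  rewrite !ww ji /block_swap; solve_ifs.
have jn : a + (c - b) < n by lia.
by exists (Ordinal jn); rewrite /= !ww ip /block_swap /=; solve_ifs.
Qed.

Lemma block_form_exists n a b c : a < b -> b < c -> c <= n ->
  exists w : 'S_n, block_form w a b c.
Proof.
move=> ab bc cn.
pose f (i : 'I_n) : 'I_n := Ordinal (ltn_block_swap a bc cn (ltn_ord i)).
have injf : injective f.
  move=> i j /(congr1 val) /= eqf; apply/val_inj.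
  by rewrite /= -(block_swapK i ab bc) eqf block_swapK.
by exists (perm injf); split=> // i; rewrite permE.
Qed.

Lemma block_form_bigrass n a b c : a < b -> b < c -> c <= n ->
  exists z : bigrass n, block_form z a b c.
Proof.
move=> ab bc cn; have [w ww] := block_form_exists ab bc cn.
suff bw : bigrassmannian w by exists (Bigrass bw).
by rewrite /bigrassmannian (block_form_descents ww)
  (block_form_descents (block_formV ww)).
Qed.

Lemma length_vector_block_form n (w : 'S_n) l1 l2 l3 l4 :
  is_length_vector w l1 l2 l3 l4 ->
  exists a b c, block_form w a b c /\
    [/\ l1 = a.+1, l2 = b - a, l3 = c - b & l4 = n.+1 - c].
Proof.
move=> [a [b [c [[ab bc cn] [wE lE]]]]]; exists a, b, c; split=> //; split=> // i.
have := congr1 (fun s => nth 0 s i) wE; rewrite /one_line.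
rewrite (nth_map i) ?size_enum_ord // nth_ord_enum !nth_cat !size_iota.
have := ltn_ord i; rewrite /block_swap; move: (nat_of_ord i) => j jn.
repeat (case: ifP => ?); rewrite ?nth_iota; lia.
Qed.

Lemma unique_descent n (w : 'S_n) : #|descents w| == 1 ->
  exists2 p, p < n & [/\ forall i j : 'I_n, i < j -> j < p -> w i < w j,
    forall i j : 'I_n, i < j -> p <= i -> w i < w j &
    exists i j : 'I_n, i < j /\ w j < w i].
Proof.
case/cards1P=> d wd.
have: d \in descents w by rewrite wd set11.
rewrite inE => /existsP[e /andP[/eqP ed lt_ed]].
have step (i j : 'I_n) : j = i.+1 :> nat -> i != d -> w i < w j.
  move=> ji ni; rewrite ltnNge leq_eqVlt;
    apply/negP=> /orP[/eqP/val_inj/perm_inj eqij|lt].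
    by move: ji; rewrite eqij; lia.
  have: i \in descents w by rewrite inE; apply/existsP; exists j; rewrite ji eqxx.
  by rewrite wd inE (negbTE ni).
have run (i j : 'I_n) : i < j -> (j <= d) || (d < i) -> w i < w j.
  elim: {j}(nat_of_ord j) {-2}j (erefl (nat_of_ord j)) => [|k IHk] j jk ij jd; first lia.
  have kn : k < n by have := ltn_ord j; lia.
  have lt_kj : w (Ordinal kn) < w j.
    by apply: step; rewrite //= -val_eqE /=; lia.
  have [eqik|neik] := eqVneq i (Ordinal kn); first by rewrite eqik.
  apply: ltn_trans lt_kj; apply: IHk => //=; move: neik; rewrite -val_eqE /=; lia.
exists d.+1; first by have := ltn_ord e; lia.
split; last by exists d, e; split=> //; lia.
- by move=> i j ij jp; apply: run => //; lia.
- by move=> i j ij jp; apply: run => //; lia.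
Qed.

Lemma run_consecutive n (w : 'S_n) p q (a : 'I_n) :
    (forall i j : 'I_n, i < j -> j < p -> w i < w j) ->
    (forall u v : 'I_n, u < v -> q <= u -> w^-1%g u < w^-1%g v) ->
    w a = q :> nat ->
  forall i : 'I_n, a <= i -> i < p -> w i = q + (i - a) :> nat.
Proof.
move=> wlt vlt wa i; case: i => i /=; elim: i => [|i IHi] ilt ai ip.
  have -> : Ordinal ilt = a by apply/val_inj => /=; lia.
  by rewrite wa; lia.
have [eqai|neai] := eqVneq (i.+1) (a : nat).
  have -> : Ordinal ilt = a by apply/val_inj => /=; lia.
  by rewrite wa; lia.
have {IHi} wi := IHi (ltnW ilt) ltac:(lia) (ltnW ip).
have lt_w := wlt (Ordinal (ltnW ilt)) (Ordinal ilt) (ltnSn _) ip.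
have vn : (w (Ordinal (ltnW ilt))).+1 < n by apply: leq_ltn_trans lt_w _.
pose v := Ordinal vn.
have [eqv|nev] := eqVneq (w (Ordinal ilt) : nat) v; first by rewrite eqv /= wi; lia.
have v1 : w (Ordinal (ltnW ilt)) < v by [].
have v2 : v < w (Ordinal ilt) by rewrite ltn_neqAle eq_sym nev.
have := vlt _ _ v1 ltac:(lia); have := vlt _ _ v2 ltac:(rewrite /=; lia).
by rewrite !permK /=; lia.
Qed.

Lemma increasing_tail_ge n (w : 'S_n) p c :
    (forall i j : 'I_n, i < j -> p <= i -> w i < w j) -> p <= c ->
    (forall i : 'I_n, c <= i -> c <= w i) ->
  forall i : 'I_n, c <= i -> i <= w i.
Proof.
move=> wlt pc wc [i /=]; elim: i => [|i IHi] ilt ci; first by [].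
have [ci'|ci'] := leqP c i; last by have := wc (Ordinal ilt) ci; rewrite /=; lia.
have := wlt (Ordinal (ltnW ilt)) (Ordinal ilt) (ltnSn _) ltac:(rewrite /=; lia).
have := IHi (ltnW ilt) ci'; lia.
Qed.

Lemma bigrass_block_form n (z : bigrass n) : exists a b c, block_form z a b c.
Proof.
case: z => w /= /andP[/unique_descent[p pn [w1 w2 [d [e [de wed]]]]]].
case/unique_descent=> q qn [v1 v2 _].
(* a is the first moved point; then w maps a to q and p to a. *)
have [a [fixa neqa]] : exists a : 'I_n, (forall i : 'I_n, i < a -> w i = i) /\ w a != a.
  case: (pickP (fun i => w i != i)) => [i0 wi0|all].
    case: (@arg_minnP _ i0 (fun i => w i != i) val wi0) => a wa mina.
    exists a; split=> // i ia; apply/eqP/negPn/negP=> /mina /=; lia.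
  have fixw i : w i = i by apply/eqP/negbFE/all.
  by move: wed; rewrite !fixw; lia.
have wfix (i : 'I_n) : w i < a -> w i = i.
  by move=> /fixa /perm_inj.
have wa_gt : a < w a.
  rewrite ltn_neqAle eq_sym neqa leqNgt; apply/negP=> /wfix wa.
  by rewrite wa eqxx in neqa.
have wVa_gt : a < w^-1%g a.
  rewrite ltn_neqAle; apply/andP; split.
    by apply: contra_neqN neqa => /eqP/val_inj Va; rewrite {1}Va permKV.
  rewrite leqNgt; apply/negP=> lt; have := fixa _ lt; rewrite permKV => Va.
  by move: lt; rewrite -Va ltnn.
have ap : a < p.
  by rewrite ltnNge; apply/negP=> pa; have := w2 _ _ wVa_gt pa; rewrite permKV; lia.
have aq : a < q.
  by rewrite ltnNge; apply/negP=> qa; have := v2 _ _ wa_gt qa; rewrite permK; lia.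
have pVa : p <= w^-1%g a.
  by rewrite leqNgt; apply/negP=> pVa; have := w1 _ _ wVa_gt pVa; rewrite permKV; lia.
have qwa : q <= w a.
  by rewrite leqNgt; apply/negP=> qwa; have := v1 _ _ wa_gt qwa; rewrite permK; lia.
have Va : w^-1%g a = p :> nat.
  apply/eqP; rewrite eqn_leq pVa andbT leqNgt; apply/negP=> lt.
  have := w2 (Ordinal pn) _ lt (leqnn _); rewrite permKV => /wfix /(congr1 val) /= wp.
  have := w2 (Ordinal pn) _ lt (leqnn _); rewrite permKV /=; lia.
have wa : w a = q :> nat.
  apply/eqP; rewrite eqn_leq qwa andbT leqNgt; apply/negP=> lt.
  have := v2 (Ordinal qn) _ lt (leqnn _); rewrite permK => lt'; have := fixa _ lt'.
  by rewrite permKV => /(congr1 val) /=; lia.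
have run1 := run_consecutive w1 v2 wa.
have run2 : forall v : 'I_n, a <= v -> v < q -> w^-1%g v = p + (v - a) :> nat.
  by apply: run_consecutive => //; rewrite invgK.
have run2w (i : 'I_n) : p <= i -> i < p + q - a -> w i = i - (p - a) :> nat.
  move=> pi iq; have vn : i - (p - a) < n by have := ltn_ord i; lia.
  have := run2 (Ordinal vn) ltac:(rewrite /=; lia) ltac:(rewrite /=; lia).
  move=> /= Vi; have <- : w^-1%g (Ordinal vn) = i by apply/val_inj; rewrite /= Vi; lia.
  by rewrite permKV /= Vi; lia.
have tailV (v : 'I_n) : p + q - a <= v -> p + q - a <= w^-1%g v.
  rewrite -{1}[v](permKV w); move: (w^-1%g v) => i.
  apply: contraTT; rewrite -!ltnNge => ilt.
  have [/fixa -> //|ai] := ltnP i a.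
  have [ip|pi] := ltnP i p; first by rewrite run1 //; lia.
  by rewrite run2w //; lia.
have tail (i : 'I_n) : p + q - a <= i -> p + q - a <= w i.
  move=> ci; rewrite leqNgt; apply/negP=> lt.
  have [/wfix wi|ai] := ltnP (w i) a; first by move: lt; rewrite wi; lia.
  have [wq|qw] := ltnP (w i) q; first by have := run2 _ ai wq; rewrite permK; lia.
  have kn : a + (w i - q) < n by have := ltn_ord (w i); lia.
  have := run1 (Ordinal kn) ltac:(rewrite /=; lia) ltac:(rewrite /=; lia).
  move=> /= wk; have /perm_inj/(congr1 val)/= : w (Ordinal kn) = w i.
    by apply/val_inj; rewrite /= wk; lia.
  lia.
have pc : p <= p + q - a by lia.
have qc : q <= p + q - a by lia.
have ge1 := increasing_tail_ge w2 pc tail.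
have ge2 := increasing_tail_ge v2 qc tailV.
exists a, q, (p + q - a); split; [lia | lia | | move=> i; rewrite /block_swap].
  have pn' : p.-1 < n by lia.
  have := run1 (Ordinal pn') ltac:(rewrite /=; lia) ltac:(rewrite /=; lia).
  have := ltn_ord (w (Ordinal pn')); rewrite /=; lia.
case: ifP => ia; first by rewrite fixa.
case: ifP => ib; first by rewrite run1; lia.
case: ifP => ic; first by rewrite run2w; lia.
have ci : p + q - a <= i by lia.
have := ge1 i ci; have := ge2 (w i) (tail i ci); rewrite permK; lia.
Qed.

Lemma reductionV n (s t : 'S_n) : reduction s t -> reduction s^-1 t^-1.
Proof.
case/existsP=> i /existsP[j /and3P[ij sji /eqP ->]].
apply/existsP; exists (s j); apply/existsP; exists (s i).
rewrite !permK sji ij /= invMg tpermV; apply/eqP.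
apply: (mulgI s); rewrite mulKVg tpermC -tpermJ conjgE !mulgA mulgV mul1g.
by rewrite -mulgA mulgV mulg1.
Qed.

Lemma bruhat_leV n (s t : 'S_n) : bruhat_le t s -> bruhat_le t^-1 s^-1.
Proof.
case/connectP=> q; elim: q s => [|u q IHq] s /=; first by move=> _ ->; apply: connect0.
case/andP=> /reductionV su uq tE; apply: bruhat_le_trans (IHq _ uq tE) _.
exact: connect1.
Qed.

Lemma bruhat_move_left n (s t : 'S_n) (i j : 'I_n) : i <= j ->
  t i = s j -> (forall k l : 'I_n, l = k.+1 :> nat -> i <= k -> k < j -> t l = s k) ->
  (forall k : 'I_n, (k < i) || (j < k) -> t k = s k) ->
  (forall k : 'I_n, i <= k -> k < j -> s j < s k) -> bruhat_le t s.
Proof.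
elim: {j}(nat_of_ord j) {-2}j (erefl (nat_of_ord j)) s => [|m IHm] j jm s ij ti tk tk' sj.
  have eqij : i = j by apply/val_inj => /=; lia.
  suff -> : t = s by exact: bruhat_le_refl.
  apply/permP=> k; have [->|ki] := eqVneq k j; first by rewrite -ti eqij.
  by apply: tk'; move: ki; rewrite -val_eqE /=; lia.
have [eqij|neij] := eqVneq i j.
  suff -> : t = s by exact: bruhat_le_refl.
  apply/permP=> k; have [->|ki] := eqVneq k j; first by rewrite -ti eqij.
  by apply: tk'; move: ki; rewrite eqij -val_eqE /=; lia.
have mn : m < n by have := ltn_ord j; lia.
have {}neij : i <= m by move: neij; rewrite -val_eqE /=; lia.
pose k0 := Ordinal mn.
have k0j : k0 < j by rewrite /=; lia.
have sE (k : 'I_n) : k != m :> nat -> k != j -> (tperm k0 j * s)%g k = s k.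
  by move=> km kj; rewrite permM tpermD // eq_sym.
have red : reduction s (tperm k0 j * s)%g.
  apply/existsP; exists k0; apply/existsP; exists j; rewrite eqxx andbT k0j /=.
  by apply: sj.
apply: bruhat_le_trans (connect1 red); apply: (IHm k0) => //.
- by rewrite permM tpermL.
- move=> k l lk ik km; rewrite sE ?(tk k) //=; rewrite -?val_eqE /=; move: km => /=; lia.
- move=> k ki; have [->|kj] := eqVneq k j.
    by rewrite permM tpermR; apply: tk => //=.
  have km : k != m :> nat by move: ki => /=; lia.
  by rewrite sE // tk' //; move: ki kj; rewrite -val_eqE /=; lia.
- move=> k ik km; rewrite [(tperm k0 j * s)%g k0]permM tpermL sE ?sj //;
  rewrite -?val_eqE /=; move: km => /=; lia.
Qed.

(** * Bruhat order between block exchanges *)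

Lemma bruhat_move_right n (s t : 'S_n) (i j : 'I_n) : i <= j ->
  t j = s i -> (forall k l : 'I_n, l = k.+1 :> nat -> i <= k -> k < j -> t k = s l) ->
  (forall k : 'I_n, (k < i) || (j < k) -> t k = s k) ->
  (forall k : 'I_n, i < k -> k <= j -> s k < s i) -> bruhat_le t s.
Proof.
move=> le_ij; have [m mE] : exists m, m = j - i by exists (j - i).
elim: m => [|m IHm] in i s le_ij mE *; move=> tj tk tk' si.
  have eqij : i = j by apply/val_inj => /=; lia.
  suff -> : t = s by exact: bruhat_le_refl.
  apply/permP=> k; have [->|ki] := eqVneq k j; first by rewrite tj eqij.
  by apply: tk'; move: ki; rewrite eqij -val_eqE /=; lia.
have mn : i.+1 < n by have := ltn_ord j; lia.
pose k0 := Ordinal mn.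
have sE (k : 'I_n) : k != i -> k != i.+1 :> nat -> (tperm i k0 * s)%g k = s k.
  by move=> ki kk; rewrite permM tpermD // eq_sym.
have red : reduction s (tperm i k0 * s)%g.
  apply/existsP; exists i; apply/existsP; exists k0; rewrite eqxx andbT ltnSn /=.
  by apply: si; rewrite /=; lia.
apply: bruhat_le_trans (connect1 red); apply: (IHm k0) => /=.
- lia.
- lia.
- by rewrite permM tpermR.
- by move=> k l lk ik km; rewrite sE ?(tk k l) // -?val_eqE /=; lia.
- move=> k ki; have [->|kj] := eqVneq k i.
    by rewrite permM tpermL; apply: tk => //=; lia.
  by rewrite sE // ?tk' //; move: ki kj; rewrite -?val_eqE /=; lia.
- move=> k ik km; rewrite [(tperm i k0 * s)%g k0]permM tpermR sE ?si //;
  rewrite -?val_eqE /=; lia.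
Qed.

Lemma block_form_le_first n (s t : 'S_n) a b c :
  block_form s a b c -> block_form t a.+1 b c -> bruhat_le t s.
Proof.
move=> [ab bc cn sE] [ab' _ _ tE].
have an : a < n by lia.
have jn : a + (c - b) < n by lia.
apply: (@bruhat_move_left _ _ _ (Ordinal an) (Ordinal jn)) => /=.
- lia.
- by apply/val_inj; rewrite /= sE tE /block_swap /=; solve_ifs.
- by move=> k l lk ak kj; apply/val_inj; rewrite /= sE tE /block_swap lk; solve_ifs.
- by move=> k kk; apply/val_inj; rewrite /= sE tE /block_swap; solve_ifs.
- by move=> k ak kj; rewrite !sE /block_swap /=; solve_ifs.
Qed.

Lemma block_form_le_last n (s t : 'S_n) a b c :
  block_form s a b c.+1 -> block_form t a b c -> bruhat_le t s.
Proof.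
move=> [ab bc cn sE] [_ bc' _ tE].
have an : c < n by lia.
have jn : a + (c - b) < n by lia.
apply: (@bruhat_move_right _ _ _ (Ordinal jn) (Ordinal an)) => /=.
- lia.
- by apply/val_inj; rewrite /= sE tE /block_swap /=; solve_ifs.
- by move=> k l lk ak kj; apply/val_inj; rewrite /= sE tE /block_swap lk; solve_ifs.
- by move=> k kk; apply/val_inj; rewrite /= sE tE /block_swap; solve_ifs.
- by move=> k ak kj; rewrite !sE /block_swap /=; solve_ifs.
Qed.

Lemma block_form_le_first_mid n (s t : 'S_n) a b c :
  block_form s a b c -> block_form t a.+1 b.+1 c -> bruhat_le t s.
Proof.
move=> sF tF; rewrite -[s]invgK -[t]invgK; apply: bruhat_leV.
have [ab bc _ _] := sF; have [_ bc' _ _] := tF.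
apply: block_form_le_first (block_formV sF) _.
have -> : a + (c - b) = a.+1 + (c - b.+1) by lia.
exact: block_formV.
Qed.

Lemma block_form_le_mid_last n (s t : 'S_n) a b c :
  block_form s a b.+1 c.+1 -> block_form t a b c -> bruhat_le t s.
Proof.
move=> sF tF; rewrite -[s]invgK -[t]invgK; apply: bruhat_leV.
by apply: block_form_le_last (block_formV sF) _; rewrite subSS; apply: block_formV.
Qed.

Lemma block_form_le n (s t : 'S_n) a b c a' b' c' :
  block_form t a b c -> block_form s a' b' c' ->
  a' <= a -> c <= c' -> b - a <= b' - a' -> c - b <= c' - b' -> bruhat_le t s.
Proof.
move=> tF; have [ab bc cn _] := tF.
have [m mE] : exists m, m = (a - a') + (c' - c) by exists ((a - a') + (c' - c)).
elim: m => [|m IHm] in a' b' c' s mE *; move=> sF aa cc ba cb; have [ab' bc' cn' _] := sF.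
  have [ea ec] : a = a' /\ c = c' by lia.
  have eb : b = b' by lia.
  subst; rewrite (block_form_inj sF tF); exact: bruhat_le_refl.
have step a1 b1 c1 : a1 < b1 -> b1 < c1 -> c1 <= n ->
   (forall u : 'S_n, block_form u a1 b1 c1 -> bruhat_le u s) ->
   m = (a - a1) + (c1 - c) ->
   a1 <= a -> c <= c1 -> b - a <= b1 - a1 -> c - b <= c1 - b1 -> bruhat_le t s.
  move=> l1 l2 l3 le mE1 l4 l5 l6 l7.
  have [u uF] := block_form_exists l1 l2 l3.
  apply: bruhat_le_trans (le u uF); exact: IHm mE1 uF l4 l5 l6 l7.
have [lt_a|ge_a] := ltnP a' a.
  have [lt_b|ge_b] := ltnP (b - a) (b' - a').
    by apply: (step a'.+1 b' c'); try lia; move=> u; apply: block_form_le_first.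
  by apply: (step a'.+1 b'.+1 c'); try lia; move=> u; apply: block_form_le_first_mid.
have [c1 c1E] : exists c1, c' = c1.+1 by exists c'.-1; lia.
have [b1 b1E] : exists b1, b' = b1.+1 by exists b'.-1; lia.
rewrite c1E in sF cc cb mE bc' cn'.
have [lt_b|ge_b] := ltnP (c - b) (c1.+1 - b').
  by apply: (step a' b' c1); try lia; move=> u; apply: block_form_le_last.
rewrite b1E in sF.
by apply: (step a' b1 c1); try lia; move=> u; apply: block_form_le_mid_last.
Qed.

(* Monotone for the Bruhat order; on block exchanges, its value at the essential
   box (a + (c - b), b) of t already decides t <= s. *)
Definition excess n (w : 'S_n) (p q : nat) := #|[set k : 'I_n | (k < p) && (q <= w k)]|.

Lemma reduction_excess n (s t : 'S_n) p q : reduction s t -> excess t p q <= excess s p q.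
Proof.
case/existsP=> i /existsP[j /and3P[ij sij /eqP ->]].
have [jp|pj] := ltnP j p; last first.
  apply/subset_leq_card/subsetP=> k; rewrite !inE permM.
  by case: tpermP => [->|->|_ _] //; lia.
rewrite /excess -(card_imset _ (@perm_inj _ (tperm i j))).
apply/subset_leq_card/subsetP=> k /imsetP[l]; rewrite !inE permM => /andP[lp ql] ->.
by rewrite ql andbT; case: tpermP => //; lia.
Qed.

Lemma bruhat_le_excess n (s t : 'S_n) p q : bruhat_le t s -> excess t p q <= excess s p q.
Proof.
case/connectP=> r; elim: r s => [|u r IHr] s /=; first by move=> _ ->.
by case/andP=> su ur tE; apply: leq_trans (IHr u ur tE) (reduction_excess _ _ su).
Qed.

Lemma count_block_swap a b c p q : a < b -> b < c ->
  count (fun k => q <= block_swap a b c k) (iota 0 p) =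
    (minn p a - q) + (minn p (a + (c - b)) - maxn a (q + a - b))
    + (minn p c - maxn (a + (c - b)) (q + (c - b))) + (p - maxn c q).
Proof.
move=> ab bc.
have min_step r x y : minn r.+1 y - x = minn r y - x + ((x <= r) && (r < y)) by lia.
have max_step r x : r.+1 - x = r - x + (x <= r) by lia.
elim: p => [|p IHp]; first by rewrite !min0n !sub0n.
rewrite -addn1 iotaD count_cat IHp /= addn1 !min_step max_step !geq_max add0n addn0.
have {IHp}-> : (q <= block_swap a b c p) = ((q <= p) && (p < a)) +
    ([&& a <= p, q + a - b <= p & p < a + (c - b)]) +
    ([&& a + (c - b) <= p, q + (c - b) <= p & p < c]) + ((c <= p) && (q <= p)) :> nat.
  clear min_step max_step; rewrite /block_swap; case: (ltnP p a) => pa.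
    have [-> ->] : (a + (c - b) <= p) = false /\ (c <= p) = false by lia.
    by rewrite andbT /= !addn0.
  case: (ltnP p (a + (c - b))) => pe; rewrite /= ?andbT ?andbF.
    have -> : (c <= p) = false by lia.
    by rewrite /= add0n !addn0; congr nat_of_bool; lia.
  case: (ltnP p c) => pc; rewrite /= ?andbT ?andbF ?add0n ?addn0 //.
  by congr nat_of_bool; lia.
by rewrite -!andbA; ring.
Qed.

Lemma excess_block_form n (w : 'S_n) a b c p q : p <= n -> block_form w a b c ->
  excess w p q =
    (minn p a - q) + (minn p (a + (c - b)) - maxn a (q + a - b))
    + (minn p c - maxn (a + (c - b)) (q + (c - b))) + (p - maxn c q).
Proof.
move=> pn [ab bc cn wE]; rewrite -count_block_swap // /excess.
rewrite cardsE cardE size_filter.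
have -> : iota 0 p = [seq k <- iota 0 n | k < p].
  have -> : n = p + (n - p) by lia.
  rewrite iotaD filter_cat (all_filterP _); last by apply/allP=> k; rewrite mem_iota.
  rewrite (eq_in_filter (a2 := pred0)) ?filter_pred0 ?cats0 //.
  by move=> k; rewrite mem_iota /=; lia.
rewrite count_filter -val_enum_ord count_map enumT; apply: eq_count => k /=.
by rewrite /= -wE andbC.
Qed.

Lemma excess_bound a x y a' x' y' : 0 < x -> 0 < y -> 0 < x' -> 0 < y' ->
    y <= (minn (a + y) a' - (a + x)) +
         (minn (a + y) (a' + y') - maxn a' (a + x - x')) +
         (minn (a + y) (a' + x' + y') - maxn (a' + y') (a + x + y')) +
         (a + y - maxn (a' + x' + y') (a + x)) ->
  a' <= a /\ a + x + y <= a' + x' + y' /\ x <= x' /\ y <= y'.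
Proof.
move=> x0 y0 x0' y0'; case: (leqP (a + y) a') => l1.
  have [-> ->] : minn (a + y) (a' + y') = a + y /\
    minn (a + y) (a' + x' + y') = a + y by lia.
  have [-> [-> ->]] : a + y - maxn (a' + x' + y') (a + x) = 0 /\
    a + y - maxn a' (a + x - x') = 0 /\ a + y - maxn (a' + y') (a + x + y') = 0 by lia.
  lia.
case: (leqP (a + y) (a' + y')) => l2.
  have -> : minn (a + y) (a' + x' + y') = a + y by lia.
  have [-> ->] : a + y - maxn (a' + x' + y') (a + x) = 0 /\
    a + y - maxn (a' + y') (a + x + y') = 0 by lia.
  by rewrite !addn0; lia.
case: (leqP (a + y) (a' + x' + y')) => l3.
  have -> : a + y - maxn (a' + x' + y') (a + x) = 0 by lia.
  rewrite addn0; case: (leqP a' (a + x)) => l4.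
    rewrite (maxn_idPr (leq_add l4 (leqnn y'))).
    case: (leqP y (x + y')) => l5; last by lia.
    have -> : a + y - (a + x + y') = 0 by lia.
    lia.
  have -> : a + y - maxn (a' + y') (a + x + y') = a + y - (a' + y') by lia.
  have -> : maxn a' (a + x - x') = a' by lia.
  lia.
case: (leqP (a' + x' + y') (a + x)) => l4.
  have -> : maxn (a' + y') (a + x + y') = a + x + y' by lia.
  have -> : maxn a' (a + x - x') = a + x - x' by lia.
  lia.
case: (leqP a' (a + x)) => l5.
  rewrite (maxn_idPr (leq_add l5 (leqnn y'))).
  case: (leqP a' (a + x - x')) => l6; lia.
have -> : maxn (a' + y') (a + x + y') = a' + y' by lia.
have -> : maxn a' (a + x - x') = a' by lia.
lia.
Qed.

Lemma block_form_leE n (s t : 'S_n) a b c a' b' c' :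
  block_form t a b c -> block_form s a' b' c' ->
  bruhat_le t s = [&& a' <= a, c <= c', b - a <= b' - a' & c - b <= c' - b'].
Proof.
move=> tF sF; have [ab bc cn _] := tF; have [ab' bc' cn' _] := sF.
apply/idP/and4P => [/bruhat_le_excess le_ts|[]]; last exact: block_form_le.
move: (le_ts (a + (c - b)) b) => {le_ts}.
have pn : a + (c - b) <= n by lia.
rewrite (excess_block_form _ pn tF) (excess_block_form _ pn sF).
have [x xE] : exists x, b = a + x by exists (b - a); lia.
have [y yE] : exists y, c = a + x + y by exists (c - b); lia.
have [x' xE'] : exists x, b' = a' + x by exists (b' - a'); lia.
have [y' yE'] : exists y, c' = a' + x' + y by exists (c' - b'); lia.
subst; rewrite !addKn.
have -> : minn (a + y) a - (a + x) = 0 by lia.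
have -> : minn (a + y) (a + x + y) - maxn (a + y) (a + x + y) = 0 by lia.
have -> : a + y - maxn (a + x + y) (a + x) = 0 by lia.
have -> : a + x + a' - (a' + x') = a + x - x' by lia.
rewrite minnn maxnn addKn add0n !addn0 => le_y.
have x0 : 0 < x by lia.
have y0 : 0 < y by lia.
have x0' : 0 < x' by lia.
have y0' : 0 < y' by lia.
by have [-> [-> [-> ->]]] := excess_bound x0 y0 x0' y0' le_y.
Qed.

(** * The Moebius function of the monoid *)

Local Open Scope ring_scope.

Lemma mobius_unique d (T : finPOrderType d) (x : T) (g : T -> int) :
    g x = 1 ->
    (forall y, (x < y)%O -> \sum_(z : T | (x <= z <= y)%O) g z = 0) ->
  forall y, (x <= y)%O -> mobius x y = g y.
Proof.
move=> gx g0 y; have [m] := ubnP #|[pred z : T | (z < y)%O]|.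
elim: m y => // m IHm y lt_ym; rewrite le_eqVlt => /predU1P[<-|lt_xy].
  by rewrite mobius_refl gx.
rewrite mobius_lt //; have := g0 y lt_xy.
rewrite (bigD1 y) /=; last by rewrite lexx (ltW lt_xy).
move/eqP; rewrite addr_eq0 => /eqP->; congr (- _).
rewrite [RHS](eq_bigl (fun z => (x <= z < y)%O)) => [|z]; last first.
  by rewrite lt_neqAle -andbA [(z <= y)%O && _]andbC.
apply: eq_bigr => z /andP[xz zy]; apply: IHm => //.
apply: leq_trans (_ : #|[pred z : T | (z < y)%O]| <= m)%N => //.
apply: proper_card; apply/properP; split.
  by apply/subsetP=> t; rewrite !inE => /lt_trans->.
by exists z; rewrite !inE ?ltxx.
Qed.

Definition quad : Type := nat * nat * nat * nat.

Definition shift (k : nat) (v : quad) : quad :=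
  let: (v1, v2, v3, v4) := v in (v1 + k, v2 + k, v3 + k, v4 + k)%N.

Definition quad_le (v e : quad) : bool :=
  let: (v1, v2, v3, v4) := v in let: (e1, e2, e3, e4) := e in
  [&& v1 <= e1, v2 <= e2, v3 <= e3 & v4 <= e4]%N.

Definition balanced (v : quad) : bool :=
  let: (v1, v2, v3, v4) := v in (v1 + v4 == v2 + v3)%N.

Definition quad_min (v : quad) : nat :=
  let: (v1, v2, v3, v4) := v in minn (minn v1 v2) (minn v3 v4).

Definition room (v e : quad) : nat :=
  let: (v1, v2, v3, v4) := v in let: (e1, e2, e3, e4) := e in
  minn (minn (e1.+1 - v1) (e2.+1 - v2)) (minn (e3.+1 - v3) (e4.+1 - v4)).

(* Values of the Moebius function at v + kT for v = 0 (j = 0), for v a generator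
   (j = 1), and for v a sum of two generators other than T (j = 2). *)
Definition coef (j k : nat) : int :=
  match j with
  | 0 => 4 - 3 * (k == 0)%:R - (k == 1)%:R
  | 1 => - 2 + (k == 0)%:R
  | _ => 1
  end.

Definition families : seq (nat * quad) :=
  [seq (0, v) | v <- [:: (0, 0, 0, 0)]] ++
  [seq (1, v) | v <- [:: (1, 1, 0, 0); (1, 0, 1, 0); (0, 1, 0, 1); (0, 0, 1, 1)]] ++
  [seq (2, v) | v <- [:: (2, 1, 1, 0); (1, 2, 0, 1); (1, 0, 2, 1); (0, 1, 1, 2)]]%N.

Definition mobius_coef (N : nat) (x : quad) : int :=
  \sum_(f <- families) \sum_(k < N) coef f.1 k * (x == shift k f.2)%:R.

Lemma shift_le k v e : quad_le (shift k v) e = (k < room v e)%N.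
Proof. by case: v e => [[[v1 v2] v3] v4] [[[e1 e2] e3] e4] /=; lia. Qed.

Lemma shift_eq k m v u : quad_min v = 0%N -> quad_min u = 0%N ->
  (shift m v == shift k u) = (m == k) && (v == u).
Proof.
case: v u => [[[v1 v2] v3] v4] [[[u1 u2] u3] u4] /= v0 u0.
by rewrite !xpair_eqE; lia.
Qed.

Lemma balanced_shift k v : balanced (shift k v) = balanced v.
Proof. by case: v => [[[v1 v2] v3] v4] /=; lia. Qed.

Lemma mobius_coef_shift N m v : quad_min v = 0%N -> (m < N)%N ->
  mobius_coef N (shift m v) = \sum_(f <- families) coef f.1 m * (v == f.2)%:R.
Proof.
move=> v0 mN; rewrite /mobius_coef; apply: eq_big_seq => f ff.
have f0 : quad_min f.2 = 0%N.
  by apply/eqP; move: f ff; apply/allP.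
rewrite (bigD1 (Ordinal mN)) //= big1 ?addr0 ?shift_eq ?eqxx // => k km.
rewrite shift_eq //; case: eqP => [mk|_]; last by rewrite mulr0.
by case/eqP: km; apply/val_inj.
Qed.

Lemma mobius_coef_eq0 N x :
  (forall m f, f \in [seq f.2 | f <- families] -> x <> shift m f) ->
  mobius_coef N x = 0.
Proof.
move=> xP; rewrite /mobius_coef; apply: big1_seq => f /andP[_ ff]; apply: big1 => k _.
by case: eqP => [/(xP k f.2)[]|]; rewrite ?mulr0 // map_f.
Qed.

Lemma sum_truncated (c : nat -> int) R N : (R <= N)%N ->
  \sum_(k < N) c k * (k < R)%:R = \sum_(k < R) c k.
Proof.
move=> RN; rewrite (big_ord_widen N _ RN) [RHS]big_mkcond /=.
by apply: eq_bigr => k _; case: ifP; rewrite ?mulr1 ?mulr0.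
Qed.

Lemma sum_coef0 R : \sum_(k < R) coef 0 k = 4 * R%:R - 3 * (0 < R)%:R - (1 < R)%:R.
Proof.
elim: R => [|R IHR]; first by rewrite big_ord0.
by rewrite big_ord_recr /= IHR /coef; lia.
Qed.

Lemma sum_coef1 R : \sum_(k < R) coef 1 k = - 2 * R%:R + (0 < R)%:R.
Proof.
elim: R => [|R IHR]; first by rewrite big_ord0.
by rewrite big_ord_recr /= IHR /coef; lia.
Qed.

Lemma eq_minn4 a b c d m : (m <= a)%N -> (m <= b)%N -> (m <= c)%N -> (m <= d)%N ->
  [|| m == a, m == b, m == c | m == d] -> minn (minn a b) (minn c d) = m.
Proof. lia. Qed.

Definition weight (e : quad) : int :=
  \sum_(f <- families) \sum_(k < room f.2 e) coef f.1 k.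

Ltac solve_minn4 :=
  repeat match goal with |- context [minn (minn ?a ?b) (minn ?c ?d)] =>
    first [ rewrite (@eq_minn4 a b c d a); [| lia | lia | lia | lia | lia]
          | rewrite (@eq_minn4 a b c d b); [| lia | lia | lia | lia | lia]
          | rewrite (@eq_minn4 a b c d c); [| lia | lia | lia | lia | lia]
          | rewrite (@eq_minn4 a b c d d); [| lia | lia | lia | lia | lia]]
  end.

Lemma weight_sorted (m s t : nat) :
  weight (m, m + s, m + s + t, m + s + s + t)%N =
  ((m, m + s, m + s + t, m + s + s + t)%N == (0, 0, 0, 0)%N)%:R.
Proof.
rewrite /weight /families !big_cons big_nil /= !sum_coef1 sum_coef0.
rewrite !sumr_const !card_ord addr0 !xpair_eqE !subSS !subn0 !subn1.
by case: s t => [|s] [|t]; rewrite ?(addn0, addnS, addSn, subSS, subn0) /=;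
  solve_minn4; lia.
Qed.

Lemma weight_symmetric (tau : quad -> quad) e :
  (forall v u, room v (tau u) = room (tau v) u) ->
  perm_eq [seq (f.1, tau f.2) | f <- families] families -> weight (tau e) = weight e.
Proof.
move=> roomC perm; rewrite /weight -[RHS](perm_big _ perm) big_map.
by apply: eq_bigr => f _; rewrite roomC.
Qed.

Lemma weight_balanced e : balanced e -> weight e = (e == (0, 0, 0, 0)%N)%:R.
Proof.
have weight14 e1 e2 e3 e4 : weight (e1, e2, e3, e4) = weight (e4, e2, e3, e1).
  pose tau (v : quad) : quad := let: (v1, v2, v3, v4) := v in (v4, v2, v3, v1).
  apply: (@weight_symmetric tau (e4, e2, e3, e1)) => //.
  by move=> [[[v1 v2] v3] v4] [[[u1 u2] u3] u4] /=; lia.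
have weight23 e1 e2 e3 e4 : weight (e1, e2, e3, e4) = weight (e1, e3, e2, e4).
  pose tau (v : quad) : quad := let: (v1, v2, v3, v4) := v in (v1, v3, v2, v4).
  apply: (@weight_symmetric tau (e1, e3, e2, e4)) => //.
  by move=> [[[v1 v2] v3] v4] [[[u1 u2] u3] u4] /=; lia.
have weightC e1 e2 e3 e4 : weight (e1, e2, e3, e4) = weight (e2, e1, e4, e3).
  pose tau (v : quad) : quad := let: (v1, v2, v3, v4) := v in (v2, v1, v4, v3).
  apply: (@weight_symmetric tau (e2, e1, e4, e3)) => //.
  by move=> [[[v1 v2] v3] v4] [[[u1 u2] u3] u4] /=; lia.
have sorted e1 e2 e3 e4 : (e1 + e4 = e2 + e3)%N -> (e1 <= e2)%N -> (e2 <= e3)%N ->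
    weight (e1, e2, e3, e4) = ((e1, e2, e3, e4) == (0, 0, 0, 0)%N)%:R.
  move=> eb l12 l23; have := weight_sorted e1 (e2 - e1) (e3 - e2).
  have -> : (e1 + (e2 - e1) = e2)%N by lia.
  have -> : (e2 + (e3 - e2) = e3)%N by lia.
  by have -> : (e2 + (e2 - e1) + (e3 - e2) = e4)%N by lia.
case: e => [[[e1 e2] e3] e4] /= /eqP eb.
wlog le14 : e1 e4 eb / (e1 <= e4)%N => [IH|].
  have [/IH->//|le] := leqP e1 e4; rewrite weight14 IH ?(ltnW le) 1?addnC //.
  by rewrite !xpair_eqE; lia.
wlog le23 : e2 e3 eb / (e2 <= e3)%N => [IH|].
  have [/IH->//|le] := leqP e2 e3; rewrite weight23 IH ?(ltnW le) // 1?eb 1?addnC //.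
  by rewrite !xpair_eqE; lia.
have [le12|/ltnW le21] := leqP e1 e2; first exact: sorted.
by rewrite weightC sorted // !xpair_eqE; lia.
Qed.

Lemma sum_families N e : balanced e -> (room (0, 0, 0, 0)%N e <= N)%N ->
  \sum_(f <- families) \sum_(k < N) coef f.1 k * (quad_le (shift k f.2) e)%:R =
  (e == (0, 0, 0, 0)%N)%:R.
Proof.
move=> eb eN; rewrite -(weight_balanced eb); apply: eq_bigr => f _.
rewrite -(@sum_truncated _ _ N); first by apply: eq_bigr => k _; rewrite shift_le.
by apply: leq_trans eN; case: f.2 e {eb} => [[[v1 v2] v3] v4] [[[e1 e2] e3] e4] /=; lia.
Qed.

Lemma sum_mobius_coef (T : finType) (P : pred T) (vec : T -> quad) N e :
    balanced e -> (room (0, 0, 0, 0)%N e <= N)%N ->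
    (forall z z', P z -> P z' -> vec z = vec z' -> z = z') ->
    (forall z, P z -> quad_le (vec z) e) ->
    (forall x, balanced x -> quad_le x e -> exists2 z, P z & vec z = x) ->
  \sum_(z | P z) mobius_coef N (vec z) = (e == (0, 0, 0, 0)%N)%:R.
Proof.
move=> eb eN vecI vecP exP; rewrite -(sum_families eb eN).
rewrite /mobius_coef exchange_big /=; apply: eq_big_seq => f ff; rewrite exchange_big /=.
apply: eq_bigr => k _; rewrite -mulr_sumr; congr (_ * _).
have fb : balanced (shift k f.2).
  by rewrite balanced_shift; move: f ff; apply/allP.
have [/(exP _ fb)[z Pz vz]|nle] := boolP (quad_le (shift k f.2) e); last first.
  apply: big1 => z Pz; case: eqP => // vz.
  by have := vecP z Pz; rewrite vz (negbTE nle).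
rewrite (bigD1 z) //= vz eqxx big1 ?addr0 // => u /andP[Pu uz].
by case: eqP => // vu; case/eqP: uz; apply: vecI => //; rewrite vu.
Qed.

(* (l1 - m1, m2 - l2, m3 - l3, l4 - m4) in terms of the triples of pi and sigma. *)
Definition relative_vector (s t : nat * nat * nat) : quad :=
  let: (a, b, c) := s in let: (a', b', c') := t in
  (a - a', (b' - a') - (b - a), (c' - b') - (c - b), c' - c)%N.

Lemma block_form_uniq n (w : 'S_n) a b c a' b' c' :
  block_form w a b c -> block_form w a' b' c' -> (a, b, c) = (a', b', c').
Proof.
move=> wF wF'; have [ab bc _ _] := wF; have [ab' bc' _ _] := wF'.
have := block_form_leE wF wF'; rewrite bruhat_le_refl => /esym/and4P[? ? ? ?].
have := block_form_leE wF' wF; rewrite bruhat_le_refl => /esym/and4P[? ? ? ?].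
by congr (_, _, _); lia.
Qed.

Ltac eval_families :=
  rewrite /families !big_cons big_nil /= ?mulr0 ?mulr1 ?add0r ?addr0.

Lemma mobius_bigrass n (pi sigma : bigrass n) a b c a' b' c' :
    block_form pi a b c -> block_form sigma a' b' c' -> (pi <= sigma)%O ->
  mobius pi sigma = mobius_coef n.+1 (relative_vector (a, b, c) (a', b', c')).
Proof.
move=> piF sigmaF.
have [tr trP] : exists tr : bigrass n -> nat * nat * nat,
    forall z : bigrass n, block_form z (tr z).1.1 (tr z).1.2 (tr z).2.
  apply: (@fin_all_exists _ _ (fun (z : bigrass n) t => block_form z t.1.1 t.1.2 t.2)).
  move=> z; have [x [y [t zF]]] := bigrass_block_form z.
  by exists (x, y, t).
have trE (z : bigrass n) x y t : block_form z x y t -> tr z = (x, y, t).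
  by move/block_form_uniq/(_ (trP z)); case: (tr z) => [[u v] w] ->.
rewrite -(trE _ _ _ _ piF) -(trE _ _ _ _ sigmaF).
apply: (mobius_unique (g := fun z => mobius_coef n.+1 (relative_vector (tr pi) (tr z)))).
  rewrite (trE _ _ _ _ piF) /= !subnn.
  rewrite (mobius_coef_shift (m := 0) (v := (0, 0, 0, 0)%N)) //.
  by eval_families.
rewrite (trE _ _ _ _ piF) => y lt_piy.
have leE (z z' : bigrass n) : (z <= z')%O = _ := block_form_leE (trP z) (trP z').
have trI z z' : tr z = tr z' -> z = z'.
  move=> eqtr; apply/val_inj/(block_form_inj (trP z)); rewrite eqtr; exact: trP.
have [ab bc cn _] := piF.
rewrite (sum_mobius_coef (e := relative_vector (a, b, c) (tr y))).
- case: eqP => // y0; suff eqy : pi = y by rewrite eqy ltxx in lt_piy.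
  apply: trI; move: (ltW lt_piy) y0; rewrite leE (trE _ _ _ _ piF).
  case: (tr y) (trP y) => [[u v] w] /= [uv vw _ _] /and4P[? ? ? ?] [? ? ? ?].
  by congr (_, _, _); lia.
- move: (ltW lt_piy); rewrite leE (trE _ _ _ _ piF).
  case: (tr y) (trP y) => [[u v] w] /= [uv vw _ _] /and4P[? ? ? ?]; lia.
- case: (tr y) (trP y) => [[u v] w] /= [uv vw _ _]; lia.
- move=> z z'; rewrite !leE (trE _ _ _ _ piF) => /andP[/and4P[z1 z2 z3 z4] _].
  move=> /andP[/and4P[z1' z2' z3' z4'] _] eqv; apply: trI.
  move: z1 z2 z3 z4 z1' z2' z3' z4' eqv.
  case: (tr z) (trP z) => [[u v] w] /= [uv vw _ _].
  case: (tr z') (trP z') => [[u' v'] w'] /= [uv' vw' _ _] ? ? ? ? ? ? ? ? [? ? ? ?].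
  by congr (_, _, _); lia.
- move=> z; rewrite !leE (trE _ _ _ _ piF) => /andP[/and4P[]].
  case: (tr z) (trP z) => [[u v] w] /= [uv vw _ _].
  case: (tr y) (trP y) => [[u' v'] w'] /= [uv' vw' _ _] ? ? ? ? /and4P[? ? ? ?].
  by apply/and4P; split; lia.
move=> [[[x1 x2] x3] x4] /= /eqP xb xle.
have [p [q [r [pE qE rE]]]] : exists p q r,
    [/\ p = a - x1, q = a - x1 + (b - a) + x2 & r = c + x4]%N.
  by do 3 eexists; split.
move: (ltW lt_piy) xle; rewrite leE (trE _ _ _ _ piF).
case: (tr y) (trP y) (leE ^~ y) => [[u v] w] /= [uv vw wn _] leEy /and4P[y1 y2 y3 y4].
move=> /and4P[? ? ? ?].
have [|||z zF] := @block_form_bigrass n p q r; [lia|lia|lia|].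
exists z; last by rewrite (trE _ _ _ _ zF) /=; congr (_, _, _, _); lia.
rewrite leE leEy (trE _ _ _ _ zF) (trE _ _ _ _ piF) /=.
by apply/andP; split; apply/and4P; split; lia.
Qed.

Theorem theorem3p10 (n : nat) (hn : (1 <= n)%N) (pi sigma : bigrass n)
    (l1 l2 l3 l4 m1 m2 m3 m4 : nat)
    (hl : is_length_vector pi l1 l2 l3 l4)
    (hm : is_length_vector sigma m1 m2 m3 m4)
    (hle : (pi <= sigma)%O) :
  let d1 := (absz (l1%:Z - m1%:Z) + 1)%N in
  let d2 := (absz (l2%:Z - m2%:Z) + 1)%N in
  let d3 := (absz (l3%:Z - m3%:Z) + 1)%N in
  let d4 := (absz (l4%:Z - m4%:Z) + 1)%N in
  (case1 d1 d2 d3 d4 -> mobius pi sigma = 1) /\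
  (case2 d1 d2 d3 d4 -> mobius pi sigma = -1) /\
  (case3 d1 d2 d3 d4 -> mobius pi sigma = 3) /\
  (case4 d1 d2 d3 d4 -> mobius pi sigma = 4) /\
  (case5 d1 d2 d3 d4 -> mobius pi sigma = 1) /\
  (case6 d1 d2 d3 d4 -> mobius pi sigma = -2) /\
  (~ case1 d1 d2 d3 d4 -> ~ case2 d1 d2 d3 d4 -> ~ case3 d1 d2 d3 d4 ->
   ~ case4 d1 d2 d3 d4 -> ~ case5 d1 d2 d3 d4 -> ~ case6 d1 d2 d3 d4 ->
   mobius pi sigma = 0).
Proof.
move=> d1 d2 d3 d4.
have [a [b [c [piF [l1E l2E l3E l4E]]]]] := length_vector_block_form hl.
have [a' [b' [c' [sigmaF [m1E m2E m3E m4E]]]]] := length_vector_block_form hm.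
have [ab bc cn _] := piF; have [ab' bc' cn' _] := sigmaF.
have := hle; rewrite [(_ <= _)%O](block_form_leE piF sigmaF) => /and4P[le1 le2 le3 le4].
rewrite (mobius_bigrass piF sigmaF hle) /=.
have -> : (a - a' = d1.-1)%N by lia.
have -> : (b' - a' - (b - a) = d2.-1)%N by lia.
have -> : (c' - b' - (c - b) = d3.-1)%N by lia.
have -> : (c' - c = d4.-1)%N by lia.
have d1n : (d1 <= n)%N by lia.
have d1p : (0 < d1)%N by lia.
have d2p : (0 < d2)%N by lia.
have d3p : (0 < d3)%N by lia.
have d4p : (0 < d4)%N by lia.
have dE : (d1 + d4 = d2 + d3)%N by lia.
move: d1 d2 d3 d4 d1n d1p d2p d3p d4p dE => d1 d2 d3 d4 {l1E l2E l3E l4E m1E m2E m3E m4E}.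
move=> {hle le1 le2 le3 le4 ab bc cn ab' bc' cn' piF sigmaF hl hm} d1n d1p d2p d3p d4p dE.
have value k v1 v2 v3 v4 r :
    (d1 = (v1 + k).+1 /\ d2 = (v2 + k).+1 /\ d3 = (v3 + k).+1 /\ d4 = (v4 + k).+1)%N ->
    quad_min (v1, v2, v3, v4) = 0%N ->
    \sum_(f <- families) coef f.1 k * ((v1, v2, v3, v4) == f.2)%:R = r ->
    mobius_coef n.+1 (d1.-1, d2.-1, d3.-1, d4.-1) = r.
  move=> [e1 [e2 [e3 e4]]] v0 <-; rewrite -(mobius_coef_shift (N := n.+1) v0); last by lia.
  by rewrite e1 e2 e3 e4.
split.
  move=> [? ? ? ?]; apply: (value 0 0 0 0 0)%N; [lia | by [] | ].
  by eval_families.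
split.
  move=> [? ?]; have [e1|e1] : d1 = 2%N \/ d1 = 1%N by lia.
    have [e2|e2] : d2 = 2%N \/ d2 = 1%N by lia.
      apply: (value 0 1 1 0 0)%N; [lia | by [] | ].
      by eval_families.
    apply: (value 0 1 0 1 0)%N; [lia | by [] | ].
    by eval_families.
  have [e2|e2] : d2 = 2%N \/ d2 = 1%N by lia.
    apply: (value 0 0 1 0 1)%N; [lia | by [] | ].
    by eval_families.
  apply: (value 0 0 0 1 1)%N; [lia | by [] | ].
  by eval_families.
split.
  move=> [? ? ? ?]; apply: (value 1 0 0 0 0)%N; [lia | by [] | ].
  by eval_families.
split.
  move=> [[|[|[|k]]] // _ [? ? ? ?]]; apply: (value k.+2 0 0 0 0)%N; [lia | by [] | ].
  by eval_families.
split.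
  move=> [[[|[|k]] // _ [? ? [[? ?]|[? ?]]]]|[[|[|k]] // _ [? ? [[? ?]|[? ?]]]]].
  - apply: (value k 1 2 0 1)%N; [lia | by [] | ].
    by eval_families.
  - apply: (value k 1 0 2 1)%N; [lia | by [] | ].
    by eval_families.
  - apply: (value k 2 1 1 0)%N; [lia | by [] | ].
    by eval_families.
  - apply: (value k 0 1 1 2)%N; [lia | by [] | ].
    by eval_families.
split.
  move=> [[|[|k]] // _ [[[? ?]|[? ?]] [[? ?]|[? ?]]]].
  - apply: (value k.+1 0 0 1 1)%N; [lia | by [] | ].
    by eval_families.
  - apply: (value k.+1 0 1 0 1)%N; [lia | by [] | ].
    by eval_families.
  - apply: (value k.+1 1 0 1 0)%N; [lia | by [] | ].
    by eval_families.
  - apply: (value k.+1 1 1 0 0)%N; [lia | by [] | ].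
    by eval_families.
move=> no1 no2 no3 no4 no5 no6; apply: mobius_coef_eq0 => m v.
have no_gen u1 u2 u3 u4 : (u1 + u4 = 1 -> u2 + u3 = 1 ->
    (d1.-1, d2.-1, d3.-1, d4.-1) <> shift m (u1, u2, u3, u4))%N.
  move=> u14 u23 [? ? ? ?]; case: (posnP m) => [m0|mp]; first by apply: no2; split; lia.
  by apply: no6; exists m.+1; [lia | rewrite /one_same_one_up; lia].
rewrite !inE => /or4P[/eqP-> [e1 e2 e3 e4] | /eqP-> | /eqP-> | ].
- case: m e1 e2 e3 e4 {no_gen} => [|[|m]] e1 e2 e3 e4.
  + by apply: no1; split; lia.
  + by apply: no3; split; lia.
  + by apply: no4; exists m.+3 => //; split; lia.
- exact: no_gen.
- exact: no_gen.
case/or4P=> [/eqP-> | /eqP-> | /eqP-> [? ? ? ?] | ].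
- exact: no_gen.
- exact: no_gen.
- by apply: no5; right; exists m.+2 => //; split; rewrite /one_up_one_down; lia.
case/or3P=> /eqP-> [? ? ? ?]; apply: no5; [left|left|right];
  exists m.+2 => //; split; rewrite /one_up_one_down; lia.
Qed.
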